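(* Let $K$ be a field, let $\mathbb{X}\subseteq\mathbb{P}^n_K$ be a $0$-dimensional locally Gorenstein scheme with no point of $\mathrm{Supp}(\mathbb{X})$ on the hyperplane $X_0=0$, and let $\sigma$ be a homogeneous trace map of degree zero of $Q^h(R)/L_0$. If $\mathbb{X}$ is an almost Gorenstein scheme, then it is a nearly Gorenstein scheme and $\mathrm{HF}_{\delta^\sigma_{\mathbb{X}}}(r_{\mathbb{X}}+1)=\mathrm{HF}_{\mathbb{X}}(1)$.
   Context: Setting. $P=K[X_0,\dots,X_n]$ has the standard grading, $I_{\mathbb{X}}\subseteq P$ is the (saturated) homogeneous vanishing ideal of $\mathbb{X}$, $R=P/I_{\mathbb{X}}$ with homogeneous maximal ideal $\mathfrak{m}$, and $\mathrm{Supp}(\mathbb{X})=\{p_1,\dots,p_s\}$ is the set of closed points. The residue class $x_0$ of $X_0$ in $R$ is a non-zerodivisor. $\mathcal{O}_{\mathbb{X},p_j}$ is the local ring at $p_j$; $\deg(\mathbb{X})=\sum_j\dim_K\mathcal{O}_{\mathbb{X},p_j}$. For a graded module $M$, $\mathrm{HF}_M(i)=\dim_KM_i$; $\mathrm{HF}_{\mathbb{X}}=\mathrm{HF}_R$; $r_{\mathbb{X}}$ is the least integer such that $\mathrm{HF}_{\mathbb{X}}(i)=\deg(\mathbb{X})$ for all $i\ge r_{\mathbb{X}}$. $\mathbb{X}$ is locally Gorenstein if every $\mathcal{O}_{\mathbb{X},p_j}$ is a Gorenstein ring. Complementary module, different, trace. $Q^h(R)=R_{x_0}$ is the localization of $R$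 at all homogeneous non-zerodivisors and $L_0=K[x_0,x_0^{-1}]$. A homogeneous trace map of degree zero of $Q^h(R)/L_0$ is a homogeneous element $\sigma$ of degree $0$ of the graded module $\underline{\mathrm{Hom}}_{L_0}(Q^h(R),L_0)$ which is a $Q^h(R)$-basis of it; it exists when $\mathbb{X}$ is locally Gorenstein. The Dedekind complementary module $\mathfrak{C}^\sigma_{\mathbb{X}}\subseteq Q^h(R)$ is the image of the injection $\underline{\mathrm{Hom}}_{K[x_0]}(R,K[x_0])\to\underline{\mathrm{Hom}}_{L_0}(Q^h(R),L_0)=Q^h(R)\sigma\cong Q^h(R)$, $\varphi\mapsto\varphi\otimes\mathrm{id}_{L_0}$ (the last isomorphism sending $g\sigma$ to $g$). The Dedekind different is $\delta^\sigma_{\mathbb{X}}=\{f\in Q^h(R)\mid f\cdot\mathfrak{C}^\sigma_{\mathbb{X}}\subseteq R\}$, a homogeneous ideal of $R$. The trace $\mathrm{tr}(\mathfrak{C}^\sigma_{\mathbb{X}})$ is the sum of the ideals $\phi(\mathfrak{C}^\sigma_{\mathbb{X}})\subseteq R$ over all $\phi\in\underline{\mathrm{Hom}}_R(\mathfrak{C}^\sigma_{\mathbb{X}},R)$; it equals $\delta^\sigma_{\mathbb{X}}\cdot\mathfrak{C}^\sigma_{\mathbb{X}}$. $\mathbb{X}$ is nearly Gorenstein if $\mathfrak{m}\subseteq\mathrm{tr}(\mathfrak{C}^\sigma_{\mathbb{X}})$. $\mathbb{X}$ is almost Gorenstein if there is an exact sequence of graded $R$-modules $0\to R\to\mathfrak{C}^\sigma_{\mathbb{X}}(-r_{\mathbb{X}})\to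 C\to0$ (degree-zero maps) with $\mathfrak{m}\cdot C=\langle0\rangle$. *)

(* Defs.v *)
From HB Require Import structures.
From mathcomp Require Import all_boot all_order all_algebra generic_quotient.
From mathcomp Require Import ring_quotient mpoly ring.
From mathcomp Require Import boolp classical_sets.

Set Implicit Arguments.
Unset Strict Implicit.
Unset Printing Implicit Defensive.

Import GRing.Theory.
Local Open Scope ring_scope.
Local Open Scope quotient_scope.

Section Localization.
Variables (A : comPzRingType) (S : mulrClosed A).
Local Notation frac := (A * {s : A | s \in S})%type.

Definition loc_eq (x y : frac) : bool :=
  `[< exists2 u, u \in S & u * (x.1 * val y.2 - y.1 * val x.2) = 0 >].

Lemma loc_eqP x y : reflect
  (exists2 u, u \in S & u * (x.1 * val y.2 - y.1 * val x.2) = 0) (loc_eq x y).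
Proof. exact: asboolP. Qed.

Lemma loc_eq_equiv : equiv_class_of loc_eq.
Proof.
split=> [x|x y|y x z].
- by apply/loc_eqP; exists 1; rewrite ?rpred1 // subrr mulr0.
- by apply/loc_eqP/loc_eqP => -[u Su e]; exists u => //;
    rewrite -opprB mulrN e oppr0.
- move=> /loc_eqP[u Su e] /loc_eqP[v Sv f]; apply/loc_eqP.
  exists (u * v * val y.2); first by rewrite !rpredM // (valP y.2).
  have -> : u * v * val y.2 * (x.1 * val z.2 - z.1 * val x.2) =
    v * val z.2 * (u * (x.1 * val y.2 - y.1 * val x.2)) +
    u * val x.2 * (v * (y.1 * val z.2 - z.1 * val y.2)) by ring.
  by rewrite e f !mulr0 addr0.
Qed.

Canonical loc_equiv := EquivRelPack loc_eq_equiv.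
Canonical loc_encModRel := defaultEncModRel loc_eq.

Definition loc := {eq_quot loc_eq}.
HB.instance Definition _ : EqQuotient _ loc_eq loc := EqQuotient.on loc.
HB.instance Definition _ := Choice.on loc.

Definition lfrac (a s : A) (Ss : s \in S) : loc := \pi_loc (a, exist _ s Ss).

Lemma lfrac_eq a s Ss b t St : (@lfrac a s Ss = @lfrac b t St) <->
  (exists2 u, u \in S & u * (a * t - b * s) = 0).
Proof.
by split=> [/eqP|h]; [rewrite piE => /loc_eqP | apply/eqP; rewrite piE; apply/loc_eqP].
Qed.

Lemma lfracW (Q : loc -> Prop) : (forall a s Ss, Q (@lfrac a s Ss)) -> forall x, Q x.
Proof. by move=> h; elim/quotW=> -[a [s Ss]]; apply: h. Qed.

Lemma loc_denM (x y : frac) : val x.2 * val y.2 \in S.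
Proof. by rewrite rpredM ?(valP x.2) ?(valP y.2). Qed.

Definition loc_zero : loc := lfrac 0 (rpred1 S).
Definition loc_one : loc := lfrac 1 (rpred1 S).
Definition loc_opp (x : loc) : loc := lfrac (- (repr x).1) (valP (repr x).2).
Definition loc_add (x y : loc) : loc :=
  lfrac ((repr x).1 * val (repr y).2 + (repr y).1 * val (repr x).2)
        (loc_denM (repr x) (repr y)).
Definition loc_mul (x y : loc) : loc :=
  lfrac ((repr x).1 * (repr y).1) (loc_denM (repr x) (repr y)).

Lemma lfrac_repr a s Ss : exists2 u, u \in S &
  u * (a * val (repr (@lfrac a s Ss)).2 - (repr (@lfrac a s Ss)).1 * s) = 0.
Proof.
case E : (repr _) => [b [t St]] /=; apply/(@lfrac_eq a s Ss b t St).
by rewrite -[LHS]reprK E.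
Qed.

Lemma lfracN a s Ss : loc_opp (@lfrac a s Ss) = lfrac (- a) Ss.
Proof.
have [u Su e] := lfrac_repr a Ss; apply/lfrac_eq; exists u => //.
set b := (repr _).1 in e *; set t := val _ in e *.
by have -> : u * (- b * s - - a * t) = u * (a * t - b * s) by ring.
Qed.

Lemma lfracD a s Ss b t St :
  loc_add (@lfrac a s Ss) (@lfrac b t St) = lfrac (a * t + b * s) (rpredM Ss St).
Proof.
have [u Su e] := lfrac_repr a Ss; have [v Sv f] := lfrac_repr b St.
apply/lfrac_eq; exists (u * v); first by rewrite rpredM.
move: e f; set a' := (repr _).1; set s' := val _; set b' := (repr _).1.
set t' := val _ => e f.
have -> : u * v * ((a' * t' + b' * s') * (s * t) - (a * t + b * s) * (s' * t')) =
  - (v * t * t' * (u * (a * s' - a' * s))) - u * s * s' * (v * (b * t' - b' * t)) by ring.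
by rewrite e f !mulr0 !oppr0 addr0.
Qed.

Lemma lfracM a s Ss b t St :
  loc_mul (@lfrac a s Ss) (@lfrac b t St) = lfrac (a * b) (rpredM Ss St).
Proof.
have [u Su e] := lfrac_repr a Ss; have [v Sv f] := lfrac_repr b St.
apply/lfrac_eq; exists (u * v); first by rewrite rpredM.
move: e f; set a' := (repr _).1; set s' := val _; set b' := (repr _).1.
set t' := val _ => e f.
have -> : u * v * (a' * b' * (s * t) - a * b * (s' * t')) =
  - (v * b' * t * (u * (a * s' - a' * s))) - u * a * s' * (v * (b * t' - b' * t)) by ring.
by rewrite e f !mulr0 !oppr0 addr0.
Qed.

Lemma lfrac_eqw a s Ss b t St : a * t = b * s -> @lfrac a s Ss = @lfrac b t St.
Proof. by move=> e; apply/lfrac_eq; exists 1; rewrite ?rpred1 // e subrr mulr0. Qed.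

Lemma loc_addA : associative loc_add.
Proof.
elim/lfracW=> a s Ss; elim/lfracW=> b t St; elim/lfracW=> c u Su.
by rewrite !lfracD; apply: lfrac_eqw; ring.
Qed.
Lemma loc_addC : commutative loc_add.
Proof.
elim/lfracW=> a s Ss; elim/lfracW=> b t St.
by rewrite !lfracD; apply: lfrac_eqw; ring.
Qed.
Lemma loc_add0 : left_id loc_zero loc_add.
Proof.
by elim/lfracW=> a s Ss; rewrite lfracD; apply: lfrac_eqw; ring.
Qed.
Lemma loc_addN : left_inverse loc_zero loc_opp loc_add.
Proof.
elim/lfracW=> a s Ss; rewrite lfracN lfracD.
by apply: lfrac_eqw; ring.
Qed.
HB.instance Definition _ := GRing.isZmodule.Build loc loc_addA loc_addC loc_add0 loc_addN.

Lemma loc_mulA : associative loc_mul.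
Proof.
elim/lfracW=> a s Ss; elim/lfracW=> b t St; elim/lfracW=> c u Su.
by rewrite !lfracM; apply: lfrac_eqw; ring.
Qed.
Lemma loc_mulC : commutative loc_mul.
Proof.
elim/lfracW=> a s Ss; elim/lfracW=> b t St.
by rewrite !lfracM; apply: lfrac_eqw; ring.
Qed.
Lemma loc_mul1 : left_id loc_one loc_mul.
Proof.
by elim/lfracW=> a s Ss; rewrite lfracM; apply: lfrac_eqw; ring.
Qed.
Lemma loc_mulD : left_distributive loc_mul loc_add.
Proof.
elim/lfracW=> a s Ss; elim/lfracW=> b t St; elim/lfracW=> c u Su.
by rewrite !(lfracD, lfracM); apply: lfrac_eqw; ring.
Qed.
HB.instance Definition _ :=
  GRing.Zmodule_isComPzRing.Build loc loc_mulA loc_mulC loc_mul1 loc_mulD.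

Lemma lfrac_opp a s Ss : - @lfrac a s Ss = lfrac (- a) Ss.
Proof. exact: lfracN. Qed.
Lemma lfrac_add a s Ss b t St :
  @lfrac a s Ss + @lfrac b t St = lfrac (a * t + b * s) (rpredM Ss St).
Proof. exact: lfracD. Qed.
Lemma lfrac_mul a s Ss b t St :
  @lfrac a s Ss * @lfrac b t St = lfrac (a * b) (rpredM Ss St).
Proof. exact: lfracM. Qed.

Definition tofrac (a : A) : loc := lfrac a (rpred1 S).

Lemma tofracB : zmod_morphism tofrac.
Proof.
move=> a b; rewrite /tofrac lfrac_opp lfrac_add.
by apply: lfrac_eqw; ring.
Qed.
Lemma tofracM : monoid_morphism tofrac.
Proof.
split=> // a b; rewrite /tofrac lfrac_mul.
by apply: lfrac_eqw; ring.
Qed.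
HB.instance Definition _ := GRing.isZmodMorphism.Build A loc tofrac tofracB.
HB.instance Definition _ := GRing.isMonoidMorphism.Build A loc tofrac tofracM.

Definition loc_scale (a : A) (x : loc) : loc := tofrac a * x.
Lemma loc_scaleA a b x : loc_scale a (loc_scale b x) = loc_scale (a * b) x.
Proof. by rewrite /loc_scale rmorphM mulrA. Qed.
Lemma loc_scale1 : left_id 1 loc_scale.
Proof. by move=> x; rewrite /loc_scale rmorph1 mul1r. Qed.
Lemma loc_scaleDr : right_distributive loc_scale +%R.
Proof. by move=> a x y; rewrite /loc_scale mulrDr. Qed.
Lemma loc_scaleDl x : {morph loc_scale^~ x : a b / a + b}.
Proof. by move=> a b; rewrite /loc_scale rmorphD mulrDl. Qed.
HB.instance Definition _ := GRing.Zmodule_isLmodule.Build A loc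
  loc_scaleA loc_scale1 loc_scaleDr loc_scaleDl.
End Localization.

(* shift gr d is the grading of M(d), for gr the grading of M. *)
Definition shift (V : Type) (gr : int -> set V) (d : int) : int -> set V :=
  fun i => gr (i + d).

Definition degree0 (V W : Type) (grV : int -> set V) (grW : int -> set W)
  (f : V -> W) := forall i x, grV i x -> grW i (f x).

Definition loc_gr (A : comPzRingType) (grA : int -> set A) (S : mulrClosed A)
  (d : int) : set (loc S) :=
  [set x | exists i j a s (Ss : s \in S),
     [/\ grA i a, grA j s, i - j = d & x = lfrac a Ss]].

Section GradedModules.
Variable A : comPzRingType.

Record is_graded_module (grA : int -> set A) (V : lmodType A) (gr : int -> set V) :
  Prop := {
  gm0 : forall i, gr i 0;
  gmB : forall i x y, gr i x -> gr i y -> gr i (x - y);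
  gmZ : forall i j a x, grA i a -> gr j x -> gr (i + j) (a *: x);
  gm_span : forall x, exists (s : seq int) (v : int -> V),
    (forall i, gr i (v i)) /\ x = \sum_(i <- s) v i;
  gm_free : forall (s : seq int) (v : int -> V), uniq s ->
    (forall i, gr i (v i)) -> \sum_(i <- s) v i = 0 -> {in s, forall i, v i = 0} }.

(* The maps V -> W that are linear over the subring B of A, with values in N. *)
Definition lin_over (B : set A) (V W : lmodType A) (N : set W) (f : V -> W) :=
  [/\ forall x y, f (x + y) = f x + f y,
      forall b x, B b -> f (b *: x) = b *: f x
    & forall x, N (f x)].

Definition hom_deg (B : set A) (V W : lmodType A) (grV : int -> set V)
  (grW : int -> set W) (N : set W) (d : int) (f : V -> W) :=
  lin_over B N f /\ degree0 grV (shift grW d) f.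

(* The graded Hom module: finite sums of homogeneous homomorphisms. *)
Definition gr_hom (B : set A) (V W : lmodType A) (grV : int -> set V)
  (grW : int -> set W) (N : set W) (f : V -> W) :=
  exists (J : finType) (d : J -> int) (phi : J -> V -> W),
    (forall j, hom_deg B grV grW N (d j) (phi j)) /\
    forall x, f x = \sum_j phi j x.

Definition injective_module (E : lmodType A) :=
  forall (M N : lmodType A) (i : {linear M -> N}) (f : {linear M -> E}),
  injective i -> exists g : {linear N -> E}, forall x, g (i x) = f x.

Definition short_exact (M E N : lmodType A) (i : M -> E) (p : E -> N) :=
  [/\ injective i, forall y, p y = 0 <-> exists x, y = i x
    & forall z, exists y, p y = z].

Fixpoint injdim_le (d : nat) (M : lmodType A) : Prop :=
  if d is d'.+1 then
    exists (E N : lmodType A) (i : {linear M -> E}) (p : {linear E -> N}),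
      [/\ injective_module E, short_exact i p & injdim_le d' N]
  else injective_module M.

Definition is_ideal (J : set A) :=
  [/\ J 0, forall x y, J x -> J y -> J (x + y) & forall a x, J x -> J (a * x)].

Definition noetherian := forall J : set A, is_ideal J ->
  exists (m : nat) (g : 'I_m -> A),
    forall a, J a <-> exists c : 'I_m -> A, a = \sum_i c i * g i.

Definition is_unit (x : A) := exists y, x * y = 1.

Definition local_ring := (1 != 0 :> A) /\
  forall x y : A, is_unit (x + y) -> is_unit x \/ is_unit y.

Definition gorenstein_local_ring :=
  [/\ noetherian, local_ring & exists d, injdim_le d A^o].
End GradedModules.

Section Dimension.
Variables (K : fieldType) (A : pzRingType) (kappa : K -> A).

Definition has_kdim (V : set A) (d : nat) := exists v : 'I_d -> A,
  (forall i, V (v i)) /\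
  forall x, V x -> exists! c : {ffun 'I_d -> K}, x = \sum_i kappa (c i) * v i.

(* The default 0 is only reached when V is not finite-dimensional, which does
   not happen for the graded pieces below, nor for the local rings of a
   zero-dimensional scheme. *)
Definition kdim (V : set A) : nat := xget 0%N (has_kdim V).
End Dimension.

Section Schemes.
Variables (K : fieldType) (n : nat).
Local Notation P := {mpoly K[n.+1]}.

Definition homogeneous_ideal (J : {pred P}) :=
  forall f d, f \in J -> pihomog mdeg d f \in J.

(* A nonempty closed subscheme of projective n-space is given by its saturated
   homogeneous vanishing ideal; an idealr is a proper ideal. *)
Record subscheme := Subscheme {
  van_ideal : idealr P;
  van_homog : homogeneous_ideal van_ideal;
  van_sat : forall f : P,
    (forall i, exists k, 'X_i ^+ k * f \in van_ideal) -> f \in van_ideal }.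

Variable X : subscheme.

(* The points of Proj (P / I). *)
Record point := Point {
  pt_ideal : prime_idealr P;
  pt_homog : homogeneous_ideal pt_ideal;
  pt_sub : {subset van_ideal X <= pt_ideal};
  pt_relevant : exists i, 'X_i \notin pt_ideal }.

(* There is a point and no strict specialization between points; in particular
   every point is closed, so that Supp(X) consists of all the points. *)
Definition zero_dimensional := (exists p : point, True) /\
  forall p q : point, {subset pt_ideal p <= pt_ideal q} ->
                      {subset pt_ideal q <= pt_ideal p}.

Definition no_point_at_infinity :=
  forall p : point, 'X_(@ord0 n) \notin pt_ideal p.

Definition coord_ring := {ideal_quot (van_ideal X)}.
HB.instance Definition _ := GRing.ComNzRing.on coord_ring.
Local Notation R := coord_ring.

Definition cls (f : P) : R := \pi_{ideal_quot (van_ideal X)} f.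
Definition coord (i : 'I_n.+1) : R := cls 'X_i.
Local Notation x0 := (coord ord0).
Definition kR (c : K) : R := cls c%:MP.

Lemma clsB : zmod_morphism cls. Proof. by move=> f g; rewrite /cls rmorphB. Qed.
Lemma clsM : monoid_morphism cls.
Proof. by split=> [|f g]; rewrite /cls ?rmorph1 ?rmorphM. Qed.
HB.instance Definition _ := GRing.isZmodMorphism.Build P R cls clsB.
HB.instance Definition _ := GRing.isMonoidMorphism.Build P R cls clsM.

Definition grR (i : int) : set R :=
  if i is Posz d then [set cls f | f in [set f : P | f \is d.-homog]]
  else [set 0].

Lemma grR0 i : grR i 0.
Proof.
by case: i => // d; exists 0; rewrite ?rmorph0 //= rpred0.
Qed.
Lemma grR1 : grR 0 1.
Proof. by exists 1; rewrite ?rmorph1 //=; apply: dhomog1. Qed.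
Lemma grRB i x y : grR i x -> grR i y -> grR i (x - y).
Proof.
case: i => [d [f hf <-] [g hg <-]|d -> ->]; last by rewrite subrr.
by exists (f - g); rewrite ?rmorphB //= rpredB.
Qed.
Lemma grRM i j x y : grR i x -> grR j y -> grR (i + j) (x * y).
Proof.
case: i j => [d|d] [e|e] /=; last 3 first.
- by move=> _ ->; rewrite mulr0; apply: grR0.
- by move=> -> _; rewrite mul0r; apply: grR0.
- by move=> -> _; rewrite mul0r.
move=> [f hf <-] [g hg <-]; exists (f * g); rewrite ?rmorphM //=.
exact: dhomogM.
Qed.

Definition max_ideal : set R :=
  [set a | exists c : 'I_n.+1 -> R, a = \sum_i c i * coord i].

Section LocalRing.
Variable p : point.

Definition hcompl : {pred R} := fun a =>
  `[< exists d f, [/\ f \is d.-homog, f \notin pt_ideal p & a = cls f] >].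

Lemma hcompl_mulr_closed : mulr_closed hcompl.
Proof.
split=> [|_ _ /asboolP[d [f [hf pf ->]]] /asboolP[e [g [hg pg ->]]]].
  apply/asboolP; exists 0%N, 1; split; rewrite ?rmorph1 ?idealr1 //.
  exact: dhomog1.
apply/asboolP; exists (d + e)%N, (f * g); split; rewrite ?rmorphM //.
  exact: dhomogM.
by rewrite prime_idealrM negb_or pf.
Qed.
HB.instance Definition _ := GRing.isMulClosed.Build R hcompl hcompl_mulr_closed.

Definition stalk_pred : {pred loc hcompl} := fun x => `[< loc_gr grR 0 x >].

Lemma stalk_subring_closed : subring_closed stalk_pred.
Proof.
split=> [|x y /asboolP + /asboolP|x y /asboolP + /asboolP].
- apply/asboolP; exists 0, 0, 1, 1, (rpred1 _); split=> //; exact: grR1.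
- move=> [i [j [a [s [Ss [ga gs ij ->]]]]]] [k [l [b [t [St [gb gt kl ->]]]]]].
  apply/asboolP; exists (i + l), (j + l), (a * t - b * s), (s * t), (rpredM Ss St).
  split; [|exact: grRM|by rewrite opprD addrACA subrr addr0|].
    have eij := subr0_eq ij; have ekl := subr0_eq kl.
    by apply: grRB; [|rewrite addrC eij -ekl]; apply: grRM.
  by rewrite lfrac_opp lfrac_add mulNr.
- move=> [i [j [a [s [Ss [ga gs ij ->]]]]]] [k [l [b [t [St [gb gt kl ->]]]]]].
  apply/asboolP; exists (i + k), (j + l), (a * b), (s * t), (rpredM Ss St).
  split; [exact: grRM|exact: grRM|by rewrite opprD addrACA ij kl|].
  by rewrite lfrac_mul.
Qed.
HB.instance Definition _ :=
  GRing.isSubringClosed.Build (loc hcompl) stalk_pred stalk_subring_closed.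

(* The local ring of X at p: degree-zero fractions f / g with g outside p. *)
Definition stalk := {x : loc hcompl | x \in stalk_pred}.
HB.instance Definition _ := SubType.on stalk.
HB.instance Definition _ := Choice.on stalk.
HB.instance Definition _ :=
  GRing.SubChoice_isSubComPzRing.Build _ _ stalk stalk_subring_closed.

Definition stalk_dim : nat :=
  kdim (fun c => tofrac hcompl (kR c)) [set x | x \in stalk_pred].
End LocalRing.

Definition locally_gorenstein := forall p : point, gorenstein_local_ring (stalk p).

Definition is_degree (d : nat) := exists (s : nat) (p : 'I_s -> point),
  (forall q : point, exists! j, pt_ideal (p j) =i pt_ideal q) /\
  d = (\sum_j stalk_dim (p j))%N.

(* Both xget below pick a uniquely determined value, which exists when X is
   zero-dimensional. *)
Definition degree : nat := xget 0%N is_degree.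

Definition HFX (i : int) : nat := kdim kR (grR i).

Definition reg_index : int := xget 0
  [set r : int | (forall i : int, (r <= i)%R -> HFX i = degree) /\
     forall r' : int, (forall i : int, (r' <= i)%R -> HFX i = degree) -> (r <= r')%R].

Definition hnzd : {pred R} := fun a =>
  `[< (exists i, grR i a) /\ forall b, a * b = 0 -> b = 0 >].

Lemma hnzd_mulr_closed : mulr_closed hnzd.
Proof.
split=> [|a b /asboolP[[i ga] za] /asboolP[[j gb] zb]]; apply/asboolP.
  by split=> [|b]; [exists 0; exact: grR1 | rewrite mul1r].
by split=> [|c]; [exists (i + j); exact: grRM | rewrite -mulrA => /za/zb].
Qed.
HB.instance Definition _ := GRing.isMulClosed.Build R hnzd hnzd_mulr_closed.

Definition Qh := loc hnzd.
HB.instance Definition _ := GRing.ComPzRing.on Qh.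
HB.instance Definition _ := GRing.Lmodule.on Qh.
Definition toQ : R -> Qh := tofrac hnzd.
HB.instance Definition _ := GRing.RMorphism.on toQ.
Definition grQ : int -> set Qh := @loc_gr _ grR hnzd.

(* K[x_0] and L_0 = K[x_0, x_0^-1] are taken as subrings of R and Q^h(R); the
   element u below is the inverse of x_0. *)
Definition Kx0 : set R := [set a | exists q : {poly K}, a = (map_poly kR q).[x0]].

Definition L0 : set Qh := [set l | exists (q : {poly K}) (u : Qh) (k : nat),
  u * toQ x0 = 1 /\ l = toQ (map_poly kR q).[x0] * u ^+ k].

Lemma grR_span (a : R) : exists (m : nat) (b : 'I_m -> R),
  (forall d : 'I_m, grR d (b d)) /\ a = \sum_d b d.
Proof.
elim/quotW: a => f; exists (msize f), (fun d => cls (pihomog mdeg d f)).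
split=> [d|]; first by exists (pihomog mdeg d f); rewrite //= pihomogP.
by rewrite -[LHS]/(cls f) {1}(pihomog_partitionE (leqnn (msize f))) rmorph_sum.
Qed.

Local Notation Hom_Kx0 :=
  (@gr_hom R Kx0 R^o R^o grR grR Kx0) (only parsing).
Local Notation Hom_L0 :=
  (@gr_hom Qh L0 Qh^o Qh^o grQ grQ L0) (only parsing).

Record trace_map := TraceMap {
  tr_fun :> Qh -> Qh;
  tr_deg0 : @hom_deg Qh L0 Qh^o Qh^o grQ grQ L0 0 tr_fun;
  tr_basis : forall phi : Qh -> Qh, Hom_L0 phi ->
    exists! g : Qh, forall x, phi x = tr_fun (g * x) }.

Variable sigma : trace_map.

(* The Dedekind complementary module: g is in it when g sigma is the extension
   phi (x) id_L0, to Q^h(R) = R (x)_K[x0] L0, of some phi : R -> K[x0]. *)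
Definition in_cmod : {pred Qh} := fun g => `[< exists phi : R -> R,
  Hom_Kx0 phi /\
  forall (r : R) (l : Qh), L0 l -> sigma (g * (toQ r * l)) = toQ (phi r) * l >].

Lemma gr_hom_zero : Hom_Kx0 (fun=> 0).
Proof.
exists void, (fun=> 0), (fun _ _ => 0); split=> [[]|x].
by rewrite big1 // => -[].
Qed.

Lemma gr_hom_add f g : Hom_Kx0 f -> Hom_Kx0 g -> Hom_Kx0 (fun x => f x + g x).
Proof.
move=> [J [d [phi [hphi ef]]]] [J' [d' [phi' [hphi' eg]]]].
exists (J + J')%type, (fun j => match j with inl j => d j | inr j => d' j end).
exists (fun j => match j with inl j => phi j | inr j => phi' j end).
split=> [[]//|x]; rewrite ef eg big_sumType; congr (_ + _).
Qed.

Lemma gr_hom_mulr a f : Hom_Kx0 f -> Hom_Kx0 (fun x => f (a * x)).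
Proof.
move=> [J [d [phi [hphi ef]]]]; have [m [b [gb ->]]] := grR_span a.
exists (J * 'I_m)%type, (fun j => d j.1 + (val j.2)%:Z).
exists (fun j x => phi j.1 (b j.2 * x)); split=> [[j k]|x] /=.
  have [[hD hZ hN] hd] := hphi j; split.
    split=> [x y|c x Bc|x //]; first by rewrite mulrDr hD.
    by rewrite -hZ // /GRing.scale /= mulrCA.
  move=> i x gx; have := hd _ _ (grRM (gb k) gx).
  by rewrite /shift (_ : k%:Z + i + d j = i + (d j + k%:Z)); last by ring.
rewrite ef -(pair_bigA _ (fun j k => phi j (b k * x))) /=.
apply: eq_bigr => j _; have [[hD hZ hN] hd] := hphi j.
rewrite mulr_suml; apply: (big_morph (phi j)) => //.
by have := hD 0 0; rewrite addr0 -[LHS]addr0 => /addrI.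
Qed.

Lemma trace_mapD x y : sigma (x + y) = sigma x + sigma y.
Proof. by have [[hD _ _] _] := tr_deg0 sigma; apply: hD. Qed.

Lemma cmod_submod_closed : submod_closed in_cmod.
Proof.
split=> [|a g h /asboolP[phi [hphi eg]] /asboolP[psi [hpsi eh]]]; apply/asboolP.
  exists (fun=> 0); split=> [|r l _]; first exact: gr_hom_zero.
  rewrite /= mul0r rmorph0 mul0r.
  by have := trace_mapD 0 0; rewrite addr0 -[LHS]addr0 => /addrI.
exists (fun x => phi (a * x) + psi x).
split=> [|r l Ll]; first exact/gr_hom_add/hpsi/gr_hom_mulr.
rewrite mulrDl trace_mapD eh // rmorphD mulrDl; congr (_ + _).
by rewrite -eg // rmorphM -[a *: g]/(toQ a * g); congr (sigma _); ring.
Qed.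
HB.instance Definition _ :=
  GRing.isSubmodClosed.Build R Qh in_cmod cmod_submod_closed.

Definition cmod := {g : Qh | g \in in_cmod}.
HB.instance Definition _ := SubType.on cmod.
HB.instance Definition _ := Choice.on cmod.
HB.instance Definition _ := [SubChoice_isSubLmodule of cmod by <:].

Definition grC (i : int) : set cmod := [set g | grQ i (val g)].

Definition trace_ideal : set R := [set a |
  exists (m : nat) (phi : 'I_m -> cmod -> R) (g : 'I_m -> cmod),
    (forall j, @gr_hom R setT cmod R^o grC grR setT (phi j)) /\
    a = \sum_j phi j (g j)].

Definition different : set Qh :=
  [set f | forall g : cmod, exists a : R, f * val g = toQ a].

Definition HFdiff (i : int) : nat :=
  kdim (fun c => toQ (kR c)) [set f | different f /\ grQ i f].

Definition nearly_gorenstein := forall a, max_ideal a -> trace_ideal a.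

Definition almost_gorenstein :=
  exists (C : lmodType R) (grQC : int -> set C)
    (iota : {linear R^o -> cmod}) (p : {linear cmod -> C}),
  [/\ is_graded_module grR grQC,
      degree0 grR (shift grC (- reg_index)) iota,
      degree0 (shift grC (- reg_index)) grQC p,
      short_exact iota p
    & forall a (c : C), max_ideal a -> a *: c = 0].

End Schemes.

(* Main.v *)
(** The image g in the complementary module of 1 under R -> C(-r) is
    homogeneous of degree -r, and since a |-> a g is injective, its numerator is
    a non-zerodivisor: g is a unit of Q^h(R).  As m kills the cokernel,
    m C <= R g, that is, m g^-1 is contained in the different.  Hence every
    a = (a g^-1) g in m lies in the trace, and a |-> a g^-1 maps R_1 onto the
    homogeneous part of degree r + 1 of the different, its inverse being
    f |-> f g. *)
Require Import Defs.
From mathcomp Require Import all_boot all_order all_algebra.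
From mathcomp Require Import ring_quotient mpoly ring boolp classical_sets.

Set Implicit Arguments.
Unset Strict Implicit.
Unset Printing Implicit Defensive.

Import GRing.Theory.
Local Open Scope ring_scope.
Local Open Scope quotient_scope.

Section Polynomials.
Variables (K : fieldType) (n : nat).
Implicit Types f g : {mpoly K[n]}.

(** Multiplying by [g] moves each homogeneous component of [f] up by [e], so only the component of
    degree [d] lands in degree [d + e]. *)
Lemma pihomogM_homog d e f g : g \is e.-homog ->
  pihomog mdeg (d + e) (f * g) = pihomog mdeg d f * g.
Proof.
move=> hg; rewrite (pihomog_partitionE (leqnn (mmeasure mdeg f))).
rewrite mulr_suml !linear_sum /= mulr_suml; apply: eq_bigr => k _.
have hk := pihomogP mdeg k f; have hkg := dhomogM hk hg.
have [<-|ne] := eqVneq (k : nat) d.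
  by rewrite (pihomog_dE hkg) (pihomog_dE hk).
by rewrite (pihomog_ne0 _ hkg) ?eqn_add2r // (pihomog_ne0 ne hk) mul0r.
Qed.

Lemma dhomog1_sum f : f \is 1.-homog -> exists c : 'I_n -> K,
  f = \sum_i (c i)%:MP * 'X_i.
Proof.
(* The only monomials of degree 1 are the variables. *)
move=> /dhomogP hf; exists (fun i => f@_U_(i)).
apply/mpolyP => m; rewrite raddf_sum /=.
under eq_bigr do rewrite mcoeffCM mcoeffX.
have [/mdeg1P[i /eqP ->]|m1] := boolP (mdeg m == 1%N).
  rewrite (bigD1 i) //= eqxx mulr1 big1 ?addr0 // => j ji.
  by rewrite eq_mnm1 (negbTE ji) mulr0.
rewrite big1 => [|i _]; last first.
  by case: eqP => [e|]; rewrite ?mulr0 //; rewrite -e mdeg1 in m1.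
apply/eqP; rewrite mcoeff_eq0; apply: contra m1 => /hf ->//.
Qed.
End Polynomials.

Section KDim.
Variables (K : fieldType) (A B : pzRingType).
Variables (kappa : K -> A) (lambda : K -> B) (phi : A -> B).
Hypotheses (phiD : {morph phi : x y / x + y}) (phi_inj : injective phi).
Hypothesis phiZ : forall c x, phi (kappa c * x) = lambda c * phi x.

(** Bases correspond under an injective semilinear map, in both directions. So the two predicates
    given to [xget] are equal, and the values agree even if the default is taken. *)
Lemma kdim_image (V : set A) : kdim lambda (phi @` V)%classic = kdim kappa V.
Proof.
have phi0 : phi 0 = 0 by have := phiD 0 0; rewrite addr0 -[LHS]addr0 => /addrI.
have phiS d (c : {ffun 'I_d -> K}) (v : 'I_d -> A) :
    \sum_i lambda (c i) * phi (v i) = phi (\sum_i kappa (c i) * v i).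
  by rewrite (big_morph phi phiD phi0); apply: eq_bigr => i _; rewrite phiZ.
rewrite /kdim; congr xget; apply/funext => d; apply/propext.
split=> [[w [Vw hw]]|[v [Vv hv]]].
  have [v hv] := choice (fun i => let: ex_intro2 x Vx e := Vw i in
    ex_intro (fun x => V x /\ phi x = w i) x (conj Vx e)).
  exists v; split=> [i|x Vx]; first by have [] := hv i.
  have ew : w = phi \o v by apply/funext => i; have [_ <-] := hv i.
  have [c [ec uc]] := hw (phi x) (ex_intro2 _ _ x Vx erefl).
  rewrite ew in ec uc; exists c; split=> [|c' e].
    by apply: phi_inj; rewrite ec -phiS.
  by apply: uc; rewrite phiS -e.
exists (phi \o v); split=> [i|_ [x Vx <-]]; first by exists (v i).
have [c [ec uc]] := hv x Vx; exists c; split=> [|c'].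
  by rewrite phiS -ec.
by rewrite phiS => /phi_inj; apply: uc.
Qed.
End KDim.

Section CoordinateRing.
Variables (K : fieldType) (n : nat) (X : subscheme K n).
Local Notation R := (coord_ring X).

Lemma cls_eq0 f : (cls X f == 0) = (f \in van_ideal X).
Proof. by rewrite -[f in RHS]subr0 Quotient.idealrBE -(rmorph0 (cls X)). Qed.

Lemma grR1_max (a : R) : grR 1 a -> max_ideal a.
Proof.
move=> [f /dhomog1_sum[c ->] <-]; exists (fun i => kR X (c i)).
by rewrite rmorph_sum; apply: eq_bigr => i _; rewrite rmorphM.
Qed.

Lemma grR_coord i : grR 1 (Defs.coord X i).
Proof. by exists 'X_i; rewrite //= dhomogX /= mdeg1. Qed.

(** Since the ideal is homogeneous, [s] kills every component of [a] outside degree [i - j]; these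
    components vanish because [s] is regular. *)
Lemma grR_divr i j (a s : R) : grR j s -> (forall b, b * s = 0 -> b = 0) ->
  grR i (a * s) -> grR (i - j) a.
Proof.
case: j => [j|j] gs zs gas; last first.
  (* In negative degree [s] is 0, and regularity then forces [a = 0]. *)
  by rewrite (zs a) ?[s]gs ?mulr0 //; apply: grR0.
move: gs zs => [t ht <-] zs in gas *.
elim/quotW: a gas => f; rewrite -/(cls X f) => gas.
have part0 d : j%:Z + d%:Z != i -> cls X (pihomog mdeg d f) = 0.
  move=> ne; apply: zs; rewrite -rmorphM; apply/eqP; rewrite cls_eq0.
  rewrite -(pihomogM_homog _ _ ht).
  case: i ne gas => [i|i] ne; last first.
    by rewrite -rmorphM /= => /eqP; rewrite cls_eq0; apply: van_homog.
  (* [f * t - h] lies in the ideal; in degree [d + j] the form [h], of degree [i], contributes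
     nothing. *)
  move=> [h hh /eqP]; rewrite -rmorphM -subr_eq0 -rmorphB cls_eq0.
  move=> /(van_homog (d + j)%N); rewrite linearB /= (pihomog_ne0 _ hh) ?sub0r.
    by rewrite rpredN.
  by rewrite eq_sym addnC; apply: contraNN ne => /eqP <-.
have -> : cls X f = \sum_(d < mmeasure mdeg f) cls X (pihomog mdeg d f).
  by rewrite {1}(pihomog_partitionE (leqnn (mmeasure mdeg f))) rmorph_sum.
apply: big_ind => [|x y gx gy|d _]; first exact: grR0.
  by rewrite -[y]opprK -[- y]sub0r; do 2?apply: grRB => //; apply: grR0.
have [<-|/part0 ->] := eqVneq (j%:Z + d%:Z) i; last exact: grR0.
by rewrite addrC addKr; exists (pihomog mdeg d f); rewrite //= pihomogP.
Qed.

Lemma hnzd_reg s : s \in @hnzd _ _ X -> forall b, b * s = 0 -> b = 0.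
Proof. by move=> /asboolP[_ h] b; rewrite mulrC; apply: h. Qed.

Lemma toQ_inj : injective (@toQ K n X).
Proof.
move=> a b /lfrac_eq[u Su]; rewrite !mulr1 mulrC => /(hnzd_reg Su).
exact: subr0_eq.
Qed.

Lemma grQ_toQ i (a : R) : grR i a -> grQ i (toQ a).
Proof.
by move=> ga; exists i, 0, a, 1, (rpred1 _); rewrite subr0; split=> //; exact: grR1.
Qed.

Lemma grQM i j x y : grQ (X := X) i x -> grQ j y -> grQ (i + j) (x * y).
Proof.
move=> [k [l [a [s [Ss [ga gs <- ->]]]]]] [k' [l' [b [t [St [gb gt <- ->]]]]]].
exists (k + k'), (l + l'), (a * b), (s * t), (rpredM Ss St).
by split; [exact: grRM | exact: grRM | ring | rewrite lfrac_mul].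
Qed.

Lemma toQ_gr i (a : R) : grQ i (toQ a) -> grR i a.
Proof.
move=> [k [l [b [s [Ss [gb gs <-]]]]]] /lfrac_eq[u Su].
rewrite mulr1 mulrC => /(hnzd_reg Su)/subr0_eq e.
by apply: (grR_divr gs (hnzd_reg Ss)); rewrite e.
Qed.

Lemma grQ_unit i g : grQ (X := X) i g -> (forall a, toQ a * g = 0 -> a = 0) ->
  exists2 g', grQ (- i) g' & g * g' = 1.
Proof.
move=> [k [l [a [s [Ss [ga gs <- ->]]]]]] reg.
have Sa : a \in @hnzd _ _ X.
  apply/asboolP; split=> [|b ab]; first by exists k.
  by apply: reg; rewrite lfrac_mul mulrC; apply: lfrac_eqw; rewrite ab !mul0r.
exists (lfrac s Sa); first by exists l, k, s, a, Sa; rewrite opprB.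
by rewrite lfrac_mul; apply: lfrac_eqw; ring.
Qed.

End CoordinateRing.

Section ComplementaryModule.
Variables (K : fieldType) (n : nat) (X : subscheme K n) (sigma : trace_map X).

(** Multiplication by [f] is a homogeneous [R]-linear map from the complementary module to [R], so a
    single summand suffices. *)
Lemma different_trace d f (g : cmod sigma) a :
  different sigma f -> grQ d f -> f * val g = toQ a -> trace_ideal sigma a.
Proof.
move=> df gf efg; have [phi hphi] := choice df.
exists 1%N, (fun=> phi), (fun=> g); split=> [_|]; last first.
  by rewrite big_ord1; apply: toQ_inj; rewrite -efg; exact: hphi.
exists 'I_1, (fun=> d), (fun=> phi); split=> [_|x]; last by rewrite big_ord1.
split=> [|i x gx]; last first.
  by apply: toQ_gr; rewrite -hphi addrC; apply: grQM.
split=> // [x y|b x _]; apply: (@toQ_inj _ _ X); rewrite -hphi.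
  by rewrite -[val _]/(val x + val y) mulrDr !hphi -rmorphD.
by rewrite -[val _]/(toQ b * val x) mulrCA hphi -rmorphM.
Qed.

Lemma trace_idealD a b :
  trace_ideal sigma a -> trace_ideal sigma b -> trace_ideal sigma (a + b).
Proof.
move=> [m [phi [g [hphi ->]]]] [m' [phi' [g' [hphi' ->]]]].
exists (m + m')%N.
exists (fun j => match split j with inl k => phi k | inr k => phi' k end).
exists (fun j => match split j with inl k => g k | inr k => g' k end).
split=> [j|]; first by case: (split j).
rewrite big_split_ord /=; congr (_ + _); apply: eq_bigr => i _.
  by rewrite -[lshift _ _]/(unsplit (inl i)) unsplitK.
by rewrite -[rshift _ _]/(unsplit (inr i)) unsplitK.
Qed.

Lemma trace_ideal0 : trace_ideal sigma 0.
Proof.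
exists 0%N, (fun _ _ => 0), (fun=> 0).
by split=> [[]|]; rewrite ?big_ord0.
Qed.

Lemma almost_gorenstein_unit : almost_gorenstein sigma ->
  exists (g : cmod sigma) (g' : Qh X),
    [/\ val g * g' = 1, grQ (- reg_index X) (val g), grQ (reg_index X) g'
      & forall a, max_ideal a -> different sigma (toQ a * g')].
Proof.
move=> [C [grQC [iota [p [_ iota_gr _ [iota_inj ker_p _] mC]]]]].
have iotaE a : val (iota a) = toQ a * val (iota 1).
  by rewrite -[a in LHS]mulr1 -[a * 1]/(a *: (1 : (coord_ring X)^o)) !linearZ.
have gg : grQ (- reg_index X) (val (iota 1)).
  by rewrite -[- _]add0r; apply: iota_gr; apply: grR1.
(* The regularity of [iota 1] required here is the injectivity of [iota]. *)
have [|g' gg' gV] := grQ_unit gg.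
  by move=> a e; apply/iota_inj/val_inj; rewrite iotaE e raddf0.
exists (iota 1), g'; split=> //; first by rewrite -[reg_index X]opprK.
(* [a *: h] dies in the cokernel, so it equals [iota b], that is [b] times [iota 1]; cancelling
   [iota 1] puts the product in [R]. *)
move=> a ma h; have [|b eb] := (ker_p (a *: h)).1; first by rewrite linearZ /= mC.
exists b; rewrite mulrAC -[toQ a * _]/(val (a *: h)) eb iotaE.
by rewrite -mulrA gV mulr1.
Qed.

End ComplementaryModule.

Theorem proposition6p6 (K : fieldType) (n : nat) (X : subscheme K n)
    (dimX : zero_dimensional X) (gorX : locally_gorenstein X)
    (infX : no_point_at_infinity X) (sigma : trace_map X) :
  almost_gorenstein sigma ->
  nearly_gorenstein sigma /\ HFdiff sigma (reg_index X + 1) = HFX X 1.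
Proof.
move=> /almost_gorenstein_unit[g [g' [gV gg gg' dg']]]; split.
  move=> _ [c ->]; apply: big_ind => [||i _]; first exact: trace_ideal0.
    exact: trace_idealD.
  have gi := grR_coord X i.
  (* The coefficient [c i] need not be homogeneous. It is attached to [g], so that the factor from
     the different stays homogeneous. *)
  apply: (@different_trace _ _ _ _ (1 + reg_index X) (toQ (Defs.coord X i) * g')
    (c i *: g)); first exact/dg'/grR1_max.
    by apply: grQM => //; apply: grQ_toQ.
  rewrite -[val _]/(toQ (c i) * val g) mulrACA -rmorphM.
  by rewrite [g' * _]mulrC gV mulr1 mulrC.
rewrite /HFdiff /HFX.
(* The map [a |-> a g'] is [K]-linear, and injective since [g'] is a unit. *)
rewrite -(@kdim_image _ _ _ (kR X) (fun c => toQ (kR X c))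
  (fun a => toQ a * g')).
- congr kdim; apply/seteqP; split=> [f [df gf]|_ [a ga <-]].
    (* The preimage of [f] is [f g], of degree [(r + 1) - r = 1]. *)
    have [a ea] := df g; exists a; last by rewrite -ea -mulrA gV mulr1.
    by apply: toQ_gr; rewrite -ea -[1](addKr (reg_index X)) addrC; apply: grQM.
  split; first exact/dg'/grR1_max.
  by rewrite addrC; apply: grQM => //; apply: grQ_toQ.
- by move=> a b; rewrite rmorphD mulrDl.
- move=> a b e; apply: (@toQ_inj _ _ X).
  by rewrite -[LHS]mulr1 -[RHS]mulr1 -gV [val g * _]mulrC !mulrA e.
- by move=> c a; rewrite rmorphM mulrA.
Qed.
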